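(* Let $\xi\in\mathbb{C}$ be a transcendental number, and let $\alpha,\beta,\mu,\omega\in\mathbb{R}$ with \[ \alpha\ge\mu>0,\quad\beta\ge\alpha+\mu\quad\text{and}\quad\omega>\alpha+\beta+\tfrac32\mu. \] Then, for infinitely many positive integers $n$, there exists no primary polynomial $Q\in\mathbb{Z}[T]$ having no root which is $0$ or a root of unity and satisfying \[ \deg(Q)\le n^\alpha,\quad H(Q)\le\exp(n^\beta)\quad\text{and}\quad\prod_{a\in A}\prod_{b\in B}|Q(\xi^{ab})|\le\exp(-n^\omega) \] for some non-empty subsets $A$ and $B$ of $\{1,2,\dots,[n^{\mu/2}]\}$.
   Context: A polynomial of $\mathbb{Z}[T]$ is primary if it is a power of an irreducible element of $\mathbb{Z}[T]$. For non-zero $F\in\mathbb{Z}[T]$, $H(F)$ is the maximum absolute value of its coefficients divided by the gcd of its coefficients. *)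

(* Defs.v *)
From mathcomp Require Import all_boot all_order all_algebra finmap.
From mathcomp Require Import complex.
From mathcomp Require Import all_classical all_reals all_analysis.

Set Implicit Arguments.
Unset Strict Implicit.
Unset Printing Implicit Defensive.

Import Order.TTheory GRing.Theory Num.Theory.

Open Scope ring_scope.

(* Irreducibility in the ring-theoretic sense: in Z[T] the prime constants are
   irreducible and a non-primitive polynomial of positive degree is not.
   [irreducible_poly] ignores constant factors, so over Z it is a different
   notion. *)
Definition irreducible_elt (D : idomainType) (p : D) : Prop :=
  [/\ p != 0, p \isn't a GRing.unit &
      forall a b : D, p = a * b -> a \is a GRing.unit \/ b \is a GRing.unit].

Definition primary (Q : {poly int}) : Prop :=
  exists (P : {poly int}) (k : nat),
    [/\ irreducible_elt P, (0 < k)%N & Q = P ^+ k].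

(* [zcontents F] is the gcd of the coefficients up to sign, hence the absolute
   value. *)
Definition height (R : realType) (F : {poly int}) : R :=
  (\max_(i < size F) `|(F`_i)%R|%N)%N%:R / `|zcontents F|%N%:R.

Definition evalC (R : realType) (Q : {poly int}) (z : R[i]) : R[i] :=
  (map_poly (intr : int -> R[i]) Q).[z].

Definition transcendental (R : realType) (z : R[i]) : Prop :=
  ~ algebraicOver (ratr : rat -> R[i]) z.

Definition no_zero_or_unity_root (R : realType) (Q : {poly int}) : Prop :=
  forall z : R[i], evalC Q z = 0 ->
    z <> 0 /\ forall m : nat, (0 < m)%N -> z ^+ m <> 1.

(* Main.v *)
(**
  If the exceptional set were finite, every large n would come with a primary
  polynomial Q_n; replace it by its primitive part Q.  If x^b and x^b' were both
  roots of Q for some b <> b', then, Q being primary, every root r of Q would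
  have some root f(r) of Q with f(r)^b = r^b', and iterating f on the finite set
  of roots would produce 0 or a root of unity.  So Q(T^b) and Q(T^b') are
  coprime, and their resultant at xi^a shows that, for each a in A, at most one b
  in B gives |Q(xi^(ab))| <= exp(- C n^(alpha + beta + mu/2)).  The others
  contribute at most exp(C n^(alpha + beta + 3 mu/2)) to the inverse of the
  product, which is negligible against exp(n^omega), so that one of the at most
  n^(mu/2) exceptional pairs satisfies
  |Q(xi^(ab))| <= exp(- 3 n^(alpha + beta + mu + e)) with e > 0.

  The polynomials F_n = Q(T^(ab)) have degree at most n^(alpha + mu) and
  logarithmic height O(n^beta), and contradict Gel'fond's criterion.  For the
  latter, the Mahler measure M makes
    w_n(F) = n^(alpha + mu) log M(F) + n^beta deg F
  additive, so F_n has an irreducible factor P_n with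
  |P_n(xi)| <= exp(- n^e w_n(P_n)); the resultant of P_n and P_(n+1) then
  vanishes, all the P_n are proportional, and P_n(xi) = 0.
*)

Require Import Defs.
From mathcomp Require Import all_boot all_order all_algebra finmap.
From mathcomp Require Import complex.
From mathcomp Require Import all_classical all_reals all_analysis.
From mathcomp Require Import ring lra zify.

Set Implicit Arguments.
Unset Strict Implicit.
Unset Printing Implicit Defensive.

Import Order.TTheory GRing.Theory Num.Theory.

Open Scope ring_scope.

(** * Mahler measure *)

Section Mahler.
Variable C : numClosedFieldType.
Implicit Types (p q : {poly C}) (s : seq C).

Definition l1norm p : C := \sum_(i < size p) `|p`_i|.

Lemma l1norm_widen n p : (size p <= n)%N -> l1norm p = \sum_(i < n) `|p`_i|.
Proof.
move=> le_pn; rewrite /l1norm (big_ord_widen n (fun i => `|p`_i|)) // big_mkcond.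
by apply: eq_bigr => i _; case: ltnP => // ?; rewrite nth_default ?normr0.
Qed.

Lemma l1norm_ge0 p : 0 <= l1norm p.
Proof. exact: sumr_ge0. Qed.

Lemma l1normD p q : l1norm (p + q) <= l1norm p + l1norm q.
Proof.
have le_pq := size_polyD p q.
rewrite !(@l1norm_widen (maxn (size p) (size q))) ?leq_maxl ?leq_maxr //.
by rewrite -big_split; apply: ler_sum => i _; rewrite coefD ler_normD.
Qed.

Lemma l1normZ c p : l1norm (c *: p) = `|c| * l1norm p.
Proof.
rewrite (@l1norm_widen (size p)) ?size_scale_leq // mulr_sumr.
by apply: eq_bigr => i _; rewrite coefZ normrM.
Qed.

Lemma l1norm_mulX p : l1norm (p * 'X) = l1norm p.
Proof.
have szX : (size (p * 'X)%R <= (size p).+1)%N.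
  by rewrite (leq_trans (size_polyMleq _ _)) // size_polyX addn2.
rewrite (l1norm_widen szX) big_ord_recl coefMX normr0 add0r.
by apply: eq_bigr => i _; rewrite coefMX.
Qed.

Lemma l1norm_sum (I : Type) (r : seq I) (F : I -> {poly C}) :
  l1norm (\sum_(i <- r) F i) <= \sum_(i <- r) l1norm (F i).
Proof.
elim: r => [|i r IH]; first by rewrite !big_nil /l1norm size_poly0 big_ord0.
by rewrite !big_cons (le_trans (l1normD _ _)) // lerD2l.
Qed.

Lemma l1normXn n : l1norm 'X^n = 1.
Proof.
elim: n => [|n IH]; last by rewrite exprSr l1norm_mulX.
by rewrite expr0 /l1norm size_poly1 big_ord1 coef1 normr1.
Qed.

Lemma l1norm_compXn n p : l1norm (p \Po 'X^n) <= l1norm p.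
Proof.
rewrite comp_polyE (le_trans (l1norm_sum _ _)) //.
by apply: ler_sum => i _; rewrite l1normZ -exprM l1normXn mulr1.
Qed.

Lemma l1norm_mulXsubC x p : l1norm (p * ('X - x%:P)) <= (1 + `|x|) * l1norm p.
Proof.
rewrite mulrBr [p * x%:P]mulrC mul_polyC -scaleNr (le_trans (l1normD _ _)) //.
by rewrite l1norm_mulX l1normZ normrN mulrDl mul1r.
Qed.

Definition roots_seq p : seq C := sval (closed_field_poly_normal p).

Lemma roots_seqE p :
  p = lead_coef p *: \prod_(x <- roots_seq p) ('X - x%:P).
Proof. exact: svalP (closed_field_poly_normal p). Qed.

(** This is max(1, |x|), written as a test because the order of [C] is only partial. *)
Definition max1 (x : C) : C := if `|x| <= 1 then 1 else `|x|.

Lemma max1_ge1 x : 1 <= max1 x.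
Proof.
rewrite /max1; case: ifP => // /negbT.
by rewrite -real_ltNge ?normr_real ?real1 // => /ltW.
Qed.

Lemma le_max1 x : `|x| <= max1 x.
Proof. by rewrite /max1; case: ifP. Qed.

Definition mahler p : C := `|lead_coef p| * \prod_(x <- roots_seq p) max1 x.

(** [roots_seq] is an arbitrary choice; uniqueness of the factorisation into linear factors makes
    any other list of roots a permutation of it. *)
Lemma mahlerE c s :
  c != 0 -> mahler (c *: \prod_(x <- s) ('X - x%:P)) = `|c| * \prod_(x <- s) max1 x.
Proof.
move=> c0; set p := c *: _.
have lp : lead_coef p = c.
  by rewrite lead_coefZ (monicP (monic_prod_XsubC _ _ _)) mulr1.
rewrite /mahler lp; congr (_ * _); apply: perm_big.
apply: prod_XsubC_eq; apply: (scalerI c0).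
by rewrite -[in LHS]lp -roots_seqE.
Qed.

Lemma mahlerM p q : p != 0 -> q != 0 -> mahler (p * q) = mahler p * mahler q.
Proof.
move=> p0 q0; rewrite {1}(roots_seqE p) {1}(roots_seqE q).
rewrite -scalerAl -scalerAr scalerA -big_cat mahlerE ?mulf_neq0 ?lead_coef_eq0 //.
by rewrite big_cat normrM mulrACA.
Qed.

Lemma mahler_ge_lead p : `|lead_coef p| <= mahler p.
Proof.
rewrite ler_peMr //; elim: (roots_seq p) => [|x s IH]; first by rewrite big_nil.
by rewrite big_cons mulr_ege1 ?max1_ge1.
Qed.

(** Multiplying in the roots one at a time, the factor T - x costs at most 1 + |x| <= 2 [max1 x]. *)
Lemma l1norm_le_mahler p : l1norm p <= 2 ^+ (size p).-1 * mahler p.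
Proof.
have [->|p0] := eqVneq p 0.
  by rewrite /l1norm size_poly0 big_ord0 mulr_ge0 ?(le_trans _ (mahler_ge_lead _)).
rewrite [in l1norm _](roots_seqE p) /mahler.
have -> : (size p).-1 = size (roots_seq p).
  rewrite [in size p](roots_seqE p) size_scale ?lead_coef_eq0 //.
  by rewrite size_prod_XsubC.
rewrite l1normZ mulrCA ler_wpM2l //.
elim: (roots_seq p) => [|x s IH]; first by rewrite !big_nil expr0 mulr1 -(expr0 'X) l1normXn.
rewrite !big_cons /= exprS mulrC (le_trans (l1norm_mulXsubC _ _)) //.
rewrite mulrACA ler_pM ?addr_ge0 ?l1norm_ge0 //.
by rewrite mulr_natl mulr2n lerD ?max1_ge1 ?le_max1.
Qed.

(** * The l2 norm and Landau's inequality *)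

Definition l2sq p : C := \sum_(i < size p) `|p`_i| ^+ 2.

Lemma l2sq_widen n p : (size p <= n)%N -> l2sq p = \sum_(i < n) `|p`_i| ^+ 2.
Proof.
move=> le_pn; rewrite /l2sq (big_ord_widen n (fun i => `|p`_i| ^+ 2)) //.
rewrite big_mkcond; apply: eq_bigr => i _.
by case: ltnP => // ?; rewrite nth_default // normr0 expr0n.
Qed.

Lemma l2sq_le_l1norm p : l2sq p <= l1norm p ^+ 2.
Proof.
rewrite /l2sq /l1norm; elim: (size p) => [|n IH].
  by rewrite !big_ord0 expr0n.
rewrite !big_ord_recr /= sqrrD -addrA lerD // lerDr mulrn_wge0 ?mulr_ge0 //.
exact: sumr_ge0.
Qed.

Lemma lead_coef_l2sq p : `|lead_coef p| ^+ 2 <= l2sq p.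
Proof.
have [->|p0] := eqVneq p 0.
  by rewrite lead_coef0 normr0 expr0n /l2sq size_poly0 big_ord0.
rewrite /l2sq lead_coefE -(@prednK (size p)) ?size_poly_gt0 //.
by rewrite big_ord_recr /= lerDr sumr_ge0 // => i _; rewrite exprn_ge0.
Qed.

(* Replacing a root by its inverse in the unit circle keeps the l2 norm. *)
Lemma l2sq_reflect x p :
  l2sq (('X - x%:P) * p) = l2sq ((x^* *: 'X - 1) * p).
Proof.
set n := (size p).+1.
have sz1 : (size (('X - x%:P) * p)%R <= n)%N.
  by rewrite (leq_trans (size_polyMleq _ _)) // size_XsubC.
have sz2 : (size ((x^* *: 'X - 1) * p)%R <= n)%N.
  have sz : (size (x^* *: 'X - 1)%R <= 2)%N.
    rewrite (leq_trans (size_polyD _ _)) // geq_max size_polyN size_poly1.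
    by rewrite (leq_trans (size_scale_leq _ _)) // size_polyX.
  rewrite (leq_trans (size_polyMleq _ _)) // -subn1 leq_subLR.
  by rewrite (leq_trans (leq_add sz (leqnn _))).
rewrite (l2sq_widen sz1) (l2sq_widen sz2); apply/eqP; rewrite -subr_eq0 -sumrB.
(* The cross terms of the two squares cancel; what remains is a multiple of the difference of the
   squared norms of [p * 'X] and [p], whose sum vanishes. *)
rewrite (eq_bigr (fun i : 'I_n =>
  (1 - `|x| ^+ 2) * (`|(p * 'X)`_i| ^+ 2 - `|p`_i| ^+ 2))); last first.
  move=> i _; rewrite mulrBl mulrBl mul1r -scalerAl ['X * p]mulrC.
  rewrite !coefB coefCM coefZ !normCK !rmorphB !rmorphM /= conjCK.
  by move: (_`_i) (p`_i) => u v; ring.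
have szX : (size (p * 'X)%R <= n)%N.
  by rewrite (leq_trans (size_polyMleq _ _)) // size_polyX addn2.
rewrite -mulr_sumr sumrB -(l2sq_widen szX) -(l2sq_widen (leqnSn _)).
rewrite (l2sq_widen szX) big_ord_recl coefMX normr0 expr0n add0r.
by under eq_bigr do rewrite coefMX; rewrite subrr mulr0.
Qed.

(** Landau's inequality: reflecting the roots outside the unit circle turns [p] into a polynomial of
    the same l2 norm, whose leading coefficient has absolute value [mahler p]. *)
Theorem mahler_le_l1norm p : mahler p <= l1norm p.
Proof.
have [->|p0] := eqVneq p 0.
  by rewrite /mahler lead_coef0 normr0 mul0r l1norm_ge0.
have mge0 : 0 <= mahler p by rewrite (le_trans _ (mahler_ge_lead _)).
rewrite -(@ler_pXn2r _ 2) ?nnegrE ?l1norm_ge0 // (le_trans _ (l2sq_le_l1norm p)) //.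
rewrite [X in l2sq X](roots_seqE p) /mahler -mul_polyC.
(* The constant is generalised to a polynomial [g] that accumulates the factors already treated. *)
have : lead_coef p = lead_coef (lead_coef p)%:P by rewrite lead_coefC.
move: (lead_coef p)%:P => g -> {p0 mge0}.
elim: (roots_seq p) g => [|x s IH] g.
  by rewrite !big_nil !mulr1 lead_coef_l2sq.
rewrite !big_cons !mulrA [g * _]mulrC /max1; case: ifP => x1.
  have := IH (('X - x%:P) * g).
  by rewrite lead_coefM lead_coefXsubC mul1r mulr1.
have := IH ((x^* *: 'X - 1) * g).
rewrite -!(mulrA _ g) l2sq_reflect; congr (_ <= _); congr ((_ * _) ^+ 2).
have x0 : x^* != 0.
  by rewrite conjC_eq0; apply: contraFneq x1 => ->; rewrite normr0 ler01.
rewrite lead_coefM lead_coefDl ?lead_coefZ ?lead_coefX ?mulr1.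
  by rewrite normrM norm_conjC mulrC.
by rewrite size_polyN size_poly1 size_scale // size_polyX.
Qed.

End Mahler.

(** * Resultants *)

Section ResultantBound.
Variable C : numClosedFieldType.

(** Expansion along the first row: the row sums of a minor are partial sums of the remaining rows of
    [A]. *)
Lemma norm_det_le n (A : 'M[C]_n) : `|\det A| <= \prod_i \sum_j `|A i j|.
Proof.
elim: n A => [|n IH] A; first by rewrite det_mx00 big_ord0 normr1.
rewrite (expand_det_row _ ord0) [leRHS]big_ord_recl mulr_suml (le_trans (ler_norm_sum _ _ _)) //.
apply: ler_sum => j _; rewrite normrM ler_wpM2l // /cofactor normrM normrX normrN1.
rewrite expr1n mul1r (le_trans (IH _)) //; apply: ler_prod => i _.
rewrite sumr_ge0 //= [leRHS](bigD1_ord j) //= ler_wpDl //.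
by apply: ler_sum => k _; rewrite !mxE.
Qed.

(** The deleted row contributes a factor at least 1 to the right-hand side, so the bound for the
    minor survives its reinsertion. *)
Lemma norm_cofactor_le n (A : 'M[C]_n) i j :
  (forall k, 1 <= \sum_l `|A k l|) ->
  `|cofactor A i j| <= \prod_k \sum_l `|A k l|.
Proof.
case: n A i j => [|n] A i j A1; first by case: i.
rewrite /cofactor normrM normrX normrN1 expr1n mul1r (le_trans (norm_det_le _)) //.
rewrite [leRHS](bigD1_ord i) //= (le_trans _ (ler_peMl _ (A1 i))) //.
  apply: ler_prod => k _; rewrite sumr_ge0 //= [leRHS](bigD1_ord j) //= ler_wpDl //.
  by apply: ler_sum => l _; rewrite !mxE.
by apply: prodr_ge0 => k _; apply: sumr_ge0.
Qed.

Lemma l1norm_mulXn (p : {poly C}) n : l1norm (p * 'X^n) = l1norm p.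
Proof.
by elim: n => [|n IH]; rewrite ?mulr1 // exprSr mulrA l1norm_mulX.
Qed.

(* Multiplying the Sylvester matrix S by the column of the powers of z gives
   the values of the X^k p and X^k q at z; the row of index 0 of adj(S) then
   expresses det S as a combination of these values. *)
Lemma resultant_le (p q : {poly C}) (z s e : C) :
    (1 < size p)%N -> (1 < size q)%N -> 1 <= l1norm p -> 1 <= l1norm q ->
    1 <= s -> `|z| <= s -> `|p.[z]| <= e -> `|q.[z]| <= e ->
  `|resultant p q| <=
    ((size q).-1 + (size p).-1)%:R * s ^+ ((size q).-1 + (size p).-1) *
    (l1norm p ^+ (size q).-1 * l1norm q ^+ (size p).-1) * e.
Proof.
move=> p_gt1 q_gt1 p1 q1 s1 zs pe qe; set dp := (size p).-1; set dq := (size q).-1.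
have dq_gt0 : (0 < dq)%N by rewrite /dq -subn1 subn_gt0.
pose S : 'M[C]_(dq + dp) := Sylvester_mx p q.
pose j0 : 'I_(dq + dp) := Ordinal (ltn_addr dp dq_gt0).
pose r (i : 'I_(dq + dp)) :=
  match fintype.split i with inl k => p * 'X^k | inr k => q * 'X^k end.
have szr i : (size (r i) <= dq + dp)%N.
  rewrite /r; case: (fintype.split i) => k; rewrite size_mulXn -?size_poly_gt0 ?(ltnW p_gt1) ?(ltnW q_gt1) //.
    by rewrite -(ltn_predK p_gt1) -/dp addnS -addSn leq_add2r.
  by rewrite -(ltn_predK q_gt1) -/dq addnS -addSn [leqRHS]addnC leq_add2r.
have SE i j : S i j = (r i)`_j.
  rewrite /S Sylvester_mxE /r; case: (fintype.split i) => k; rewrite coefMXn ltnNge if_neg;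
  by rewrite mulrb.
have rowE i : \sum_j `|S i j| = l1norm (r i).
  by rewrite (l1norm_widen (szr i)); apply: eq_bigr => j _; rewrite SE.
have r1 i : 1 <= l1norm (r i).
  by rewrite /r; case: (fintype.split i) => k; rewrite l1norm_mulXn.
have prodE : \prod_i \sum_j `|S i j| = l1norm p ^+ dq * l1norm q ^+ dp.
  under eq_bigr do rewrite rowE.
  rewrite big_split_ord /=; congr (_ * _).
    under eq_bigr do rewrite /r (unsplitK (inl _)) l1norm_mulXn.
    by rewrite prodr_const card_ord.
  under eq_bigr do rewrite /r (unsplitK (inr _)) l1norm_mulXn.
  by rewrite prodr_const card_ord.
have detE : resultant p q = \sum_i cofactor S i j0 * (r i).[z].
  pose v : 'cV[C]_(dq + dp) := \col_j z ^+ j.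
  have /matrixP/(_ j0 0) : \adj S *m (S *m v) = (\det S)%:M *m v.
    by rewrite mulmxA mul_adj_mx.
  rewrite mul_scalar_mx !mxE expr0 mulr1 /resultant -/S => <-.
  apply: eq_bigr => i _; rewrite !mxE (horner_coef_wide _ (szr i)); congr (_ * _).
  by apply: eq_bigr => j _; rewrite SE mxE.
have e0 : 0 <= e by apply: le_trans pe.
have s0 : 0 <= s by apply: le_trans s1.
have rz i : `|(r i).[z]| <= s ^+ (dq + dp) * e.
  have zk k : (k <= dq + dp)%N -> `|z| ^+ k <= s ^+ (dq + dp).
    by move=> le_k; rewrite (le_trans (lerXn2r _ _ _ zs)) ?nnegrE // ler_weXn2l.
  rewrite /r; case: (fintype.split i) => k; rewrite hornerM hornerXn normrM normrX mulrC;
    apply: ler_pM; rewrite ?exprn_ge0 //; apply: zk; apply: (leq_trans (ltnW (ltn_ord k))).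
    exact: leq_addr.
  exact: leq_addl.
rewrite detE (le_trans (ler_norm_sum _ _ _)) //.
have -> : (dq + dp)%:R * s ^+ (dq + dp) * (l1norm p ^+ dq * l1norm q ^+ dp) * e =
    \sum_(i < dq + dp) (\prod_k \sum_l `|S k l|) * (s ^+ (dq + dp) * e).
  by rewrite sumr_const card_ord -mulr_natl prodE; ring.
apply: ler_sum => i _; rewrite normrM ler_pM //.
by rewrite norm_cofactor_le // => k; rewrite rowE.
Qed.

End ResultantBound.

(** * Integer polynomials *)

Lemma intr_norm_ge1 (K : numDomainType) (a : int) : a != 0 -> 1 <= `|a%:~R : K|.
Proof. by move=> a0; rewrite -intr_norm (ler1z K) -gtz0_ge1 normr_gt0. Qed.

Section IntegerPolynomials.
Variable C : numClosedFieldType.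
Implicit Types p q : {poly int}.

Local Notation pZtoQ := (map_poly (intr : int -> rat)).
Local Notation pQtoC := (map_poly (ratr : rat -> C)).
Local Notation pZtoC := (map_poly (intr : int -> C)).

Lemma pQtoC_int p : pQtoC (pZtoQ p) = pZtoC p.
Proof. by rewrite -map_poly_comp; apply: eq_map_poly => x /=; rewrite ratr_int. Qed.

Lemma size_pZtoC p : size (pZtoC p) = size p.
Proof. by apply: size_map_inj_poly => //; apply: intr_inj. Qed.

Lemma lead_coef_pZtoC p : lead_coef (pZtoC p) = (lead_coef p)%:~R.
Proof. by apply: lead_coef_map_inj => //; apply: intr_inj. Qed.

Lemma mahler_int_ge1 p : p != 0 -> 1 <= mahler (pZtoC p).
Proof.
move=> p0; rewrite (le_trans _ (mahler_ge_lead _)) // lead_coef_pZtoC.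
by rewrite intr_norm_ge1 // lead_coef_eq0.
Qed.

Lemma l1norm_int_ge1 p : p != 0 -> 1 <= l1norm (pZtoC p).
Proof. by move=> p0; rewrite (le_trans (mahler_int_ge1 p0)) ?mahler_le_l1norm. Qed.

Lemma irreducible_dvdp (p q : {poly rat}) x :
  irreducible_poly p -> root (pQtoC p) x -> root (pQtoC q) x -> p %| q.
Proof.
move=> irr_p px qx; have: root (pQtoC (gcdp p q)) x by rewrite gcdp_map root_gcd px.
move=> gx; have: gcdp p q %= p.
  apply: irr_p; last exact: dvdp_gcdl.
  apply: contraTneq gx => /eqP/size_poly1P[c c0 ->].
  by rewrite map_polyC rootC fmorph_eq0.
by move=> /eqp_dvdl <-; apply: dvdp_gcdr.
Qed.

Lemma resultant_pZtoC p q :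
  (resultant p q)%:~R = resultant (pZtoC p) (pZtoC q).
Proof.
rewrite /resultant /Sylvester_mx !size_pZtoC.
rewrite -det_map_mx /= map_col_mx; congr (\det (col_mx _ _));
  by apply: map_lin1_mx => v; rewrite map_poly_rV rmorphM /= map_rVpoly.
Qed.

Lemma resultant_common_root (p q : {poly C}) :
  resultant p q = 0 -> exists x, root p x /\ root q x.
Proof.
move=> /eqP; rewrite resultant_eq0 => gt1.
have /closed_rootP[x] : size (gcdp p q) != 1%N by rewrite neq_ltn gt1 orbT.
by rewrite root_gcd => /andP[]; exists x.
Qed.

(** The resultant is a non-zero integer, hence at least 1 in absolute value, while [resultant_le]
    bounds it from above. *)
Lemma coprime_values_ge p q (z s e : C) :
    (1 < size p)%N -> (1 < size q)%N ->
    (forall x, root (pZtoC p) x -> root (pZtoC q) x -> False) ->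
    1 <= s -> `|z| <= s -> `|(pZtoC p).[z]| <= e -> `|(pZtoC q).[z]| <= e ->
  1 <= ((size q).-1 + (size p).-1)%:R * s ^+ ((size q).-1 + (size p).-1) *
    (l1norm (pZtoC p) ^+ (size q).-1 * l1norm (pZtoC q) ^+ (size p).-1) * e.
Proof.
move=> p1 q1 ncr s1 zs pe qe.
have p0 : p != 0 by rewrite -size_poly_gt0 ltnW.
have q0 : q != 0 by rewrite -size_poly_gt0 ltnW.
have r0 : resultant p q != 0.
  apply/eqP => r0; have := resultant_pZtoC p q; rewrite r0 => /esym.
  by case/resultant_common_root => x [/ncr].
apply: le_trans (intr_norm_ge1 C r0) _; rewrite resultant_pZtoC.
by have := @resultant_le C (pZtoC p) (pZtoC q) z s e; rewrite !size_pZtoC; apply;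
  rewrite ?l1norm_int_ge1.
Qed.

(** The two polynomials divide each other over the rationals. In this form, the value at a point
    divided by the leading coefficient is seen to be the same for both. *)
Lemma irreducible_int_assoc p q x :
  irreducible_poly p -> irreducible_poly q ->
  root (pZtoC p) x -> root (pZtoC q) x ->
  (lead_coef q)%:~R *: pZtoC p = (lead_coef p)%:~R *: pZtoC q.
Proof.
move=> /irreducible_rat_int irr_p /irreducible_rat_int irr_q.
rewrite -!pQtoC_int => px qx.
have /eqpfP : pZtoQ p %= pZtoQ q by rewrite /eqp !(@irreducible_dvdp _ _ x).
have lc r : lead_coef (pZtoQ r) = (lead_coef r)%:~R.
  by apply: lead_coef_map_inj => //; apply: intr_inj.
rewrite !lc => E; rewrite [pZtoQ p]E linearZ /= scalerA.
rewrite -[X in X * _](ratr_int C) -rmorphM /= mulrC divfK ?ratr_int //.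
rewrite intr_eq0 lead_coef_eq0.
by have := irredp_neq0 irr_q; rewrite -!size_poly_gt0 size_rat_int_poly.
Qed.

(* Elimination: the resultant in T of p(T) and T^b - Y^b' is a rational
   polynomial in Y vanishing at one root of p, hence at all of them. *)
Lemma irreducible_root_exp (p : {poly rat}) b b' x y :
    irreducible_poly p -> (0 < b)%N -> root (pQtoC p) x -> root (pQtoC p) y ->
    y ^+ b = x ^+ b' ->
  forall x1, root (pQtoC p) x1 -> exists y1, root (pQtoC p) y1 /\ y1 ^+ b = x1 ^+ b'.
Proof.
move=> irr_p b0 px py yx x1 px1; have p0 := irredp_neq0 irr_p.
pose q : {poly {poly rat}} := 'X^b - ('X^b')%:P.
pose f (t : C) : {rmorphism {poly rat} -> C} := horner_eval t \o pQtoC.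
have fp t : map_poly (f t) p^:P = pQtoC p.
  rewrite -map_poly_comp; apply: eq_map_poly => c /=.
  by rewrite map_polyC /= /horner_eval hornerC.
have fq t : map_poly (f t) q = 'X^b - (t ^+ b')%:P.
  rewrite rmorphB /= map_polyXn map_polyC /=.
  by rewrite map_polyXn /horner_eval hornerXn.
(* Specialising Y at [t] commutes with the resultant, since neither leading coefficient vanishes. *)
have fr t : f t (resultant p^:P q) = resultant (pQtoC p) ('X^b - (t ^+ b')%:P).
  rewrite map_resultant ?fp ?fq //.
    by rewrite lead_coef_map_inj //= ?map_polyC /= /horner_eval ?hornerC ?fmorph_eq0
      ?lead_coef_eq0 //; apply: polyC_inj.
  by rewrite lead_coefXnsubC // rmorph1 oner_eq0.
have rx : root (pQtoC (resultant p^:P q)) x.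
  rewrite rootE -[X in X == _]/(f x _) fr resultant_eq0.
  have g0 : gcdp (pQtoC p) ('X^b - (x ^+ b')%:P) != 0.
    by rewrite gcdp_eq0 map_poly_eq0 (negPf p0).
  have : root (gcdp (pQtoC p) ('X^b - (x ^+ b')%:P)) y.
    by rewrite root_gcd py rootE !hornerE yx subrr eqxx.
  exact: root_size_gt1.
have r1 : root (pQtoC (resultant p^:P q)) x1.
  have /dvdpP[u ->] := irreducible_dvdp irr_p px rx.
  by rewrite rmorphM rootM px1 orbT.
move: r1; rewrite rootE -[X in X == _]/(f x1 _) fr => /eqP.
case/resultant_common_root => y1 [py1].
by rewrite rootE !hornerE subr_eq0 => /eqP; exists y1.
Qed.

(** Elimination gives a self-map [f] of the finite set of roots with [f z ^+ b = z ^+ b']. A root d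
    fixed by the r-th iterate satisfies d^(b^r) = d^(b'^r), with different exponents. *)
Lemma irreducible_two_powers (p : {poly rat}) b b' x :
    irreducible_poly p -> (0 < b)%N -> (0 < b')%N -> b != b' ->
    root (pQtoC p) (x ^+ b) -> root (pQtoC p) (x ^+ b') ->
  exists2 y, root (pQtoC p) y & y = 0 \/ exists2 m, (0 < m)%N & y ^+ m = 1.
Proof.
move=> irr_p b0 b'0 bb' pxb pxb'.
pose s := roots_seq (pQtoC p).
have p0 : pQtoC p != 0 by rewrite map_poly_eq0 irredp_neq0.
have ps z : root (pQtoC p) z = (z \in s).
  by rewrite (roots_seqE (pQtoC p)) rootZ ?lead_coef_eq0 // root_prod_XsubC.
pose f z := nth 0 s (find (fun t => t ^+ b == z ^+ b') s).
have fP z : z \in s -> f z \in s /\ f z ^+ b = z ^+ b'.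
  rewrite -ps => pz; have : has (fun t => t ^+ b == z ^+ b') s.
    have yx : (x ^+ b') ^+ b = (x ^+ b) ^+ b' by rewrite -!exprM mulnC.
    have [y1 [py1 y1z]] := irreducible_root_exp irr_p b0 pxb pxb' yx pz.
    by apply/hasP; exists y1; rewrite -?ps ?y1z.
  move=> hs; rewrite mem_nth -?has_find //; split => //.
  by apply/eqP; have := nth_find 0 hs.
have xs : x ^+ b \in s by rewrite -ps.
have fs k z : z \in s -> iter k f z \in s.
  by move=> zs; elim: k => //= k /fP[].
(* Pigeonhole: an orbit without repetition would be longer than the list of roots. *)
have : looping f (x ^+ b) (size s).
  rewrite -[looping _ _ _]negbK -looping_uniq; apply/negP => /uniq_leq_size le_s.
  suff : (size (traject f (x ^+ b) (size s).+1) <= size s)%N by rewrite size_traject ltnn.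
  by apply: le_s => z /trajectP[k _ ->]; apply: fs.
move=> /trajectP[i lt_i]; rewrite -(subnKC (ltnW lt_i)) addnC iterD.
(* The orbit comes back to [d] after [r] further steps. *)
set d := iter i f _; set r := (_ - _)%N => rd.
have r0 : (0 < r)%N by rewrite subn_gt0.
have ds : d \in s by apply: fs.
have itE k : (iter k f d) ^+ (b ^ k) = d ^+ (b' ^ k).
  elim: k => // k IH; rewrite iterS expnS exprM (fP _ (fs k d ds)).2.
  by rewrite exprAC IH -exprM expnSr.
exists d; first by rewrite ps.
have [->|dn0] := eqVneq d 0; [by left | right].
have := itE r; rewrite rd.
have [lt|lt|/eqP] := ltngtP (b ^ r)%N (b' ^ r)%N; last by rewrite eqn_exp2r // (negPf bb').
  exists (b' ^ r - b ^ r)%N; first by rewrite subn_gt0.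
  by apply: (mulfI (expf_neq0 (b ^ r) dn0)); rewrite mulr1 -exprD subnKC // ltnW.
exists (b ^ r - b' ^ r)%N; first by rewrite subn_gt0.
by apply: (mulfI (expf_neq0 (b' ^ r) dn0)); rewrite mulr1 -exprD subnKC // ltnW.
Qed.

End IntegerPolynomials.

(** Gauss's lemma turns a rational divisor into a scalar multiple of an integral factor of [p]; that
    factor is not constant, so its cofactor is a unit. *)
Lemma irreducible_elt_poly (p : {poly int}) :
  irreducible_elt p -> (1 < size p)%N -> irreducible_poly p.
Proof.
case=> p0 _ irr p1; apply/irreducible_rat_int; split; first by rewrite size_rat_int_poly.
move=> q q1 /dvdpP_rat_int[p1' [a a0 qE] [r pE]].
move: q1; rewrite qE size_scale // size_rat_int_poly => p1'1.
apply: eqp_trans (eqp_scale _ a0) _; rewrite pE.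
case: (irr _ _ pE).
  by rewrite poly_unitE => /andP[]; rewrite (negPf p1'1).
rewrite poly_unitE => /andP[/size_poly1P[c c0 ->] _].
by rewrite mulrC mul_polyC map_polyZ /= eqp_sym eqp_scale // intr_eq0.
Qed.

(** Descent on the size: a reducible polynomial splits into two factors of positive degree, and
    goodness passes to one of them. *)
Lemma exists_irreducible_factor (good : {poly int} -> Prop) (F : {poly int}) :
    (1 < size F)%N -> good F ->
    (forall g h : {poly int}, (1 < size g)%N -> (1 < size h)%N -> good (g * h) -> good g \/ good h) ->
  exists p r : {poly int}, [/\ irreducible_poly p, good p & F = p * r].
Proof.
move=> F1 gF split_good; have [n] := ubnP (size F).
elim: n F F1 gF => // n IH F F1 gF ltFn.
have [irr|] := pselect (irreducible_poly F).
  by exists F, 1; rewrite mulr1.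
move=> nirr; have [[g h] [g1 h1 FE]] : exists gh : {poly int} * {poly int},
    [/\ (1 < size gh.1)%N, (1 < size gh.2)%N & F = gh.1 * gh.2].
  apply: contrapT => H; apply: nirr; apply/irreducible_rat_int.
  split=> [|q q1 /dvdpP_rat_int[g [a a0 qE] [h FE]]]; first by rewrite size_rat_int_poly.
  move: q1; rewrite qE size_scale // size_rat_int_poly => g1.
  have F0 : F != 0 by rewrite -size_poly_gt0 ltnW.
  move: F0; rewrite FE mulf_eq0 negb_or => /andP[g0 h0].
  apply: eqp_trans (eqp_scale _ a0) _.
  have [h1|h1] := ltnP 1 (size h).
    case: H; exists (g, h); split => //=.
    by rewrite ltn_neqAle eq_sym g1 size_poly_gt0.
  have /eqP/size_poly1P[c c0 ->] : size h = 1%N.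
    by apply/eqP; rewrite eqn_leq h1 size_poly_gt0.
  by rewrite mulrC mul_polyC map_polyZ /= eqp_sym eqp_scale // intr_eq0.
move=> /= in g1 h1 FE; have g0 : g != 0 by rewrite -size_poly_gt0 ltnW.
have h0 : h != 0 by rewrite -size_poly_gt0 ltnW.
have szF : size F = (size g + size h).-1 by rewrite FE size_mul.
have aux (a b c : nat) : c = (a + b).-1 -> (1 < b)%N -> (c < n.+1)%N -> (a < n)%N by lia.
have [gg|gh] : good g \/ good h by apply: split_good => //; rewrite -FE.
  case: (IH g) => // [|p [r [irr gp gE]]]; first exact: (aux _ _ _ szF).
  by exists p, (r * h); rewrite mulrA -gE.
case: (IH h) => // [|p [r [irr gp hE]]]; first by rewrite addnC in szF; exact: (aux _ _ _ szF).
by exists p, (r * g); rewrite mulrA -hE mulrC.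
Qed.

(** * Real logarithmic form of the bounds *)

Section RealBounds.
Variable R : realType.
Implicit Types p q : {poly int}.

Local Notation pZtoC := (map_poly (intr : int -> R[i])).

(** The norm of [R[i]] takes its values in [R[i]]; this is the same number as an element of [R],
    where [expR] and [ln] live. *)
Definition cabs (z : R[i]) : R := complex.Re `|z|.

Lemma cabsE z : `|z| = (cabs z)%:C%C.
Proof. by rewrite /cabs normc_def. Qed.

Lemma complex_ge0E (z : R[i]) : 0 <= z -> z = (complex.Re z)%:C%C.
Proof. by move=> z0; have := cabsE z; rewrite /cabs ger0_norm. Qed.

Lemma cabs_ge0 z : 0 <= cabs z.
Proof. by rewrite -lecR -cabsE normr_ge0. Qed.

Lemma cabsM z t : cabs (z * t) = cabs z * cabs t.
Proof. by apply: (@complexI R); rewrite rmorphM /= -!cabsE normrM. Qed.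

Lemma cabsX z n : cabs (z ^+ n) = cabs z ^+ n.
Proof. by apply: (@complexI R); rewrite rmorphXn /= -!cabsE normrX. Qed.

Lemma cabs_eq0 z : (cabs z == 0) = (z == 0).
Proof. by rewrite -[RHS]normr_eq0 cabsE -(inj_eq (@complexI R)). Qed.

Lemma cabsV z : cabs z^-1 = (cabs z)^-1.
Proof. by apply: (@complexI R); rewrite fmorphV /= -!cabsE normfV. Qed.

Lemma cabs_int_ge1 (a : int) : a != 0 -> 1 <= cabs a%:~R.
Proof. by move=> a0; rewrite -lecR -cabsE; apply: intr_norm_ge1. Qed.

Definition log_mahler p : R := ln (complex.Re (mahler (pZtoC p))).

Lemma mahler_expR p : p != 0 -> mahler (pZtoC p) = (expR (log_mahler p))%:C%C.
Proof.
move=> p0; have m1 := mahler_int_ge1 R[i] p0.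
have mE := complex_ge0E (le_trans ler01 m1).
rewrite /log_mahler lnK -?mE // posrE; rewrite mE -[1]/(1%:C%C) lecR in m1.
exact: lt_le_trans m1.
Qed.

Lemma log_mahler_ge0 p : p != 0 -> 0 <= log_mahler p.
Proof.
move=> p0; have := mahler_int_ge1 R[i] p0.
by rewrite mahler_expR // -[1]/(1%:C%C) lecR -expR0 ler_expR.
Qed.

Lemma log_mahlerM p q :
  p != 0 -> q != 0 -> log_mahler (p * q) = log_mahler p + log_mahler q.
Proof.
move=> p0 q0; apply: (@expR_inj R); apply: (@complexI R).
have nz r : r != 0 -> pZtoC r != 0.
  by rewrite -!size_poly_gt0 size_pZtoC.
rewrite -mahler_expR ?mulf_neq0 // (rmorphM (map_poly _)) /= mahlerM ?nz //.
by rewrite !mahler_expR // -rmorphM /= -expRD.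
Qed.

Lemma log_mahler_le p t :
  p != 0 -> l1norm (pZtoC p) <= (expR t)%:C%C -> log_mahler p <= t.
Proof.
move=> p0 le_t; rewrite -ler_expR -lecR -mahler_expR //.
exact: le_trans (mahler_le_l1norm _) le_t.
Qed.

(** The power of 2 lost against the Mahler measure is absorbed by the exponential of the degree, as
    2 <= e. *)
Lemma l1norm_le_expR p : p != 0 ->
  l1norm (pZtoC p) <= (expR ((size p).-1%:R + log_mahler p))%:C%C.
Proof.
move=> p0; rewrite expRD rmorphM /= -mahler_expR // (le_trans (l1norm_le_mahler _)) //.
rewrite size_pZtoC ler_wpM2r ?(le_trans ler01 (mahler_int_ge1 _ p0)) //.
rewrite -[(size p).-1%:R]mul1r expRM_natr rmorphXn /= lerXn2r ?nnegrE //.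
  by rewrite -[0]/(0%:C%C) lecR expR_ge0.
have -> : 2 = (1 + 1)%:C%C :> R[i] by rewrite rmorphD /=.
by rewrite lecR expR_ge1Dx.
Qed.

Lemma natr_le_expR n : n%:R <= expR n%:R :> R.
Proof. by rewrite (le_trans _ (expR_ge1Dx _)) // lerDr. Qed.

(** Logarithm of [coprime_values_ge]; the factor N in front is absorbed by N <= e^N, which accounts
    for the 1 in [1 + c]. *)
Lemma coprime_values_lb p q (z : R[i]) (c hp hq v : R) :
    (1 < size p)%N -> (1 < size q)%N ->
    (forall x, root (pZtoC p) x -> root (pZtoC q) x -> False) ->
    0 <= c -> cabs z <= expR c ->
    l1norm (pZtoC p) <= (expR hp)%:C%C -> l1norm (pZtoC q) <= (expR hq)%:C%C ->
    cabs (evalC p z) <= expR (- v) -> cabs (evalC q z) <= expR (- v) ->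
  v <= (1 + c) * ((size p).-1%:R + (size q).-1%:R) +
       (hp * (size q).-1%:R + hq * (size p).-1%:R).
Proof.
move=> p1 q1 ncr c0 zc php qhq pv qv.
have := @coprime_values_ge R[i] p q z (expR c)%:C%C (expR (- v))%:C%C p1 q1 ncr.
rewrite !cabsE -[1]/(1%:C%C) !lecR.
rewrite -{1}expR0 ler_expR => /(_ c0 zc pv qv); rewrite addnC.
set dp := (size p).-1; set dq := (size q).-1 => H.
rewrite -subr_ge0 -ler_expR expR0 -lecR (le_trans H) //.
set N := (dp + dq)%N.
have -> : (1 + c) * (dp%:R + dq%:R) + (hp * dq%:R + hq * dp%:R) - v =
  N%:R + c * N%:R + (hp * dq%:R + hq * dp%:R) - v by rewrite /N natrD; ring.
rewrite !expRD !rmorphM /= ler_wpM2r //; first by rewrite -[0]/(0%:C%C) lecR expR_ge0.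
apply: ler_pM.
- by rewrite -rmorphXn /= mulr_ge0 ?ler0n // -[0]/(0%:C%C) lecR exprn_ge0 ?expR_ge0.
- by rewrite mulr_ge0 ?exprn_ge0 ?l1norm_ge0.
- rewrite expRM_natr rmorphXn /= ler_wpM2r //.
    by rewrite -rmorphXn /= -[0]/(0%:C%C) lecR exprn_ge0 ?expR_ge0.
  by rewrite -[N%:R in X in X <= _](rmorph_nat (@real_complex R)) lecR natr_le_expR.
by rewrite !expRM_natr !rmorphXn /= ler_pM ?exprn_ge0 ?l1norm_ge0 // lerXn2r ?nnegrE
  ?l1norm_ge0 // -[0]/(0%:C%C) lecR expR_ge0.
Qed.

End RealBounds.

(** * Gel'fond's criterion *)

Section Gelfond.
Variable R : realType.
Implicit Types p q : {poly int}.

Local Notation pZtoC := (map_poly (intr : int -> R[i])).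

Lemma evalCM p q (z : R[i]) : evalC (p * q) z = evalC p z * evalC q z.
Proof. by rewrite /evalC rmorphM hornerM. Qed.

(* Up to a constant, D and h bound the degree and the logarithmic height of the
   polynomials competing with p, so that the weight bounds the logarithm of a
   resultant of p with any of them. *)
Definition weight (D h : R) p : R := D * log_mahler R p + h * (size p).-1%:R.

Lemma weightM D h p q : p != 0 -> q != 0 ->
  weight D h (p * q) = weight D h p + weight D h q.
Proof.
move=> p0 q0; rewrite /weight log_mahlerM // size_mul //.
have -> : (size p + size q).-1.-1 = ((size p).-1 + (size q).-1)%N.
  by move: p0 q0; rewrite -!size_poly_gt0; case: (size p) (size q) => [|a] [|b] //= _ _;
    rewrite addnS.
by rewrite natrD !mulrDr addrACA.
Qed.

Lemma weight_gt0 D h p : 0 <= D -> 0 < h -> (1 < size p)%N -> 0 < weight D h p.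
Proof.
move=> D0 h0 p1; have p0 : p != 0 by rewrite -size_poly_gt0 ltnW.
apply: (@lt_le_trans _ _ (h * (size p).-1%:R)).
  by rewrite mulr_gt0 // ltr0n -subn1 subn_gt0.
by rewrite lerDr mulr_ge0 ?log_mahler_ge0.
Qed.

(* The weight is additive, so the quotient log |F(z)| / weight F is a weighted
   mean of the same quotients for the factors of F. *)
Lemma irreducible_factor_small (D h y : R) (z : R[i]) (F : {poly int}) :
    (1 < size F)%N -> cabs (evalC F z) <= expR (- (y * weight D h F)) ->
  exists p, [/\ irreducible_poly p, (size p <= size F)%N,
    log_mahler R p <= log_mahler R F &
    cabs (evalC p z) <= expR (- (y * weight D h p))].
Proof.
move=> F1 Fz.
have [g k g1 k1 Hgk|p [r [irr Hp FE]]] := exists_irreducible_factor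
  (good := fun p => cabs (evalC p z) <= expR (- (y * weight D h p))) F1 Fz.
  have g0 : g != 0 by rewrite -size_poly_gt0 ltnW.
  have k0 : k != 0 by rewrite -size_poly_gt0 ltnW.
  have [|lt_g] := leP (cabs (evalC g z)) (expR (- (y * weight D h g))); first by left.
  (* Were both factors above their bounds, additivity of the weight would put the product above its
     own. *)
  right; rewrite leNgt; apply/negP => lt_k; move: Hgk; apply/negP; rewrite -ltNge.
  rewrite evalCM cabsM weightM // mulrDr opprD expRD.
  by apply: ltr_pM => //; apply: expR_ge0.
have F0 : F != 0 by rewrite -size_poly_gt0 ltnW.
move: F0; rewrite FE mulf_eq0 negb_or => /andP[p0 r0].
exists p; split; [exact: irr | | | exact: Hp].
  rewrite size_mul //; move: r0; rewrite -size_poly_gt0; case: (size r) => // m _.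
  by rewrite addnS leq_addr.
by rewrite log_mahlerM // lerDl log_mahler_ge0.
Qed.

(** [L] is the bound of [coprime_values_lb] with logarithmic lengths [d + m] and [d' + m']. Each of
    its terms is compared with a term of either weight; [kap] is lost only in passing from primed
    parameters to unprimed ones. *)
Lemma resultant_exponent_bound (kap c d d' D D' h h' m m' : R) :
    1 <= kap -> 0 <= c -> 1 <= d -> 1 <= d' -> d <= D -> d' <= D' ->
    0 <= m -> 0 <= m' -> m <= 2 * h -> m' <= 2 * h' -> D <= h -> D' <= h' ->
    D <= D' -> h <= h' -> D' <= kap * D -> h' <= kap * h ->
  let L := (1 + c) * (d + d') + ((d + m) * d' + (d' + m') * d) in
  L <= kap * (7 + 2 * c) * (D * m + h * d) /\
  L <= kap * (7 + 2 * c) * (D' * m' + h' * d').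
Proof.
move=> kap1 c0 d1 d1' dD dD' m0 m0' mh mh' Dh Dh' DD hh Dk hk L.
have h0 : 0 <= h by lra.
have w'0 : 0 <= D' * m' + h' * d' by rewrite addr_ge0 ?mulr_ge0 //; lra.
have hd : h' <= kap * (h * d).
  apply: le_trans hk _; rewrite ler_wpM2l ?ler_peMr //; lra.
have hd' : h' <= h' * d' by rewrite ler_peMr //; lra.
split.
- have e1 : (1 + c) * (d + d') <= (1 + c) * (2 * (kap * (h * d))).
    by rewrite ler_wpM2l //; lra.
  have e2 : d * d' <= kap * (h * d).
    by rewrite mulrC mulrA ler_wpM2r //; lra.
  have e3 : m * d' <= kap * (D * m).
    by rewrite mulrC mulrA ler_wpM2r //; lra.
  have e4 : m' * d <= 2 * (kap * (h * d)).
    by rewrite !mulrA ler_wpM2r //; lra.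
  have e5 : 0 <= kap * (D * m) by rewrite !mulr_ge0 //; lra.
  have e6 : 0 <= c * (kap * (D * m)) by rewrite !mulr_ge0 //; lra.
  rewrite /L; lra.
apply: (@le_trans _ _ ((7 + 2 * c) * (D' * m' + h' * d'))); last first.
  rewrite ler_wpM2r // ler_peMl //; lra.
have e1 : (1 + c) * (d + d') <= (1 + c) * (2 * (h' * d')).
  by rewrite ler_wpM2l //; lra.
have e2 : d * d' <= h' * d' by rewrite ler_wpM2r //; lra.
have e3 : m * d' <= 2 * (h' * d') by rewrite mulrA ler_wpM2r //; lra.
have e4 : m' * d <= D' * m' by rewrite mulrC ler_wpM2r //; lra.
have e5 : 0 <= D' * m' by rewrite mulr_ge0 //; lra.
have e6 : 0 <= c * (D' * m') by rewrite mulr_ge0.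
rewrite /L; lra.
Qed.

(** Without a common root, the resultant bound would limit [y] times the smaller weight to
    [kap * (7 + 2 * c)] times that weight. *)
Lemma small_irreducible_common_root p q (z : R[i]) (kap c D D' h h' y : R) :
    irreducible_poly p -> irreducible_poly q ->
    1 <= kap -> 0 <= c -> cabs z <= expR c ->
    (size p).-1%:R <= D -> (size q).-1%:R <= D' ->
    log_mahler R p <= 2 * h -> log_mahler R q <= 2 * h' -> D <= h -> D' <= h' ->
    D <= D' -> h <= h' -> D' <= kap * D -> h' <= kap * h ->
    kap * (7 + 2 * c) < y ->
    cabs (evalC p z) <= expR (- (y * weight D h p)) ->
    cabs (evalC q z) <= expR (- (y * weight D' h' q)) ->
  exists x, root (pZtoC p) x /\ root (pZtoC q) x.
Proof.
move=> irr_p irr_q kap1 c0 zc pD qD ph qh Dh Dh' DD hh Dk hk ky pz qz.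
apply: contrapT => ncr.
have sz (r : {poly int}) : irreducible_poly r -> 1 <= (size r).-1%:R :> R.
  by case=> r1 _; rewrite ler1n -subn1 subn_gt0.
have p0 := irredp_neq0 irr_p; have q0 := irredp_neq0 irr_q.
have p1 := sz _ irr_p; have q1 := sz _ irr_q.
have mp := log_mahler_ge0 R p0; have mq := log_mahler_ge0 R q0.
have [b1 b2] := resultant_exponent_bound kap1 c0 p1 q1 pD qD mp mq ph qh Dh Dh' DD hh Dk hk.
(* The resultant needs one bound valid for both values, hence the minimum of the two weights. *)
have [w wE] : exists w, w = Num.min (weight D h p) (weight D' h' q) by eexists.
have w_gt0 : 0 < w.
  have h0 := lt_le_trans ltr01 (le_trans p1 (le_trans pD Dh)).
  have h0' := lt_le_trans ltr01 (le_trans q1 (le_trans qD Dh')).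
  rewrite wE lt_min (weight_gt0 (le_trans (ler0n _ _) pD) h0 irr_p.1).
  by rewrite (weight_gt0 (le_trans (ler0n _ _) qD) h0' irr_q.1).
have y0 : 0 <= y.
  apply: ltW; apply: le_lt_trans ky; rewrite mulr_ge0 ?(le_trans ler01 kap1) //.
  by rewrite addr_ge0 ?mulr_ge0.
have pw : cabs (evalC p z) <= expR (- (y * w)).
  by apply: le_trans pz _; rewrite ler_expR lerN2 ler_wpM2l // wE ge_min lexx.
have qw : cabs (evalC q z) <= expR (- (y * w)).
  by apply: le_trans qz _; rewrite ler_expR lerN2 ler_wpM2l // wE ge_min lexx orbT.
have ncr' x : root (pZtoC p) x -> root (pZtoC q) x -> False.
  by move=> px qx; apply: ncr; exists x.
have L := coprime_values_lb irr_p.1 irr_q.1 ncr' c0 zc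
  (l1norm_le_expR R p0) (l1norm_le_expR R q0) pw qw.
have : y * w <= kap * (7 + 2 * c) * w.
  rewrite {2}wE minEle; case: ifP => _.
    exact: le_trans L b1.
  exact: le_trans L b2.
by rewrite ler_pM2r // leNgt ky.
Qed.

Lemma powRn_gt_eventually (e K : R) : 0 < e ->
  exists n0 : nat, forall n : nat, (n0 <= n)%N -> K < n%:R `^ e.
Proof.
move=> e0; pose M := Num.max K 1; pose t := M `^ e^-1.
have M0 : 0 <= M by rewrite le_max ler01 orbT.
have t0 : 0 <= t by apply: powR_ge0.
exists (Num.truncn t).+1 => n le_n.
have lt_tn : t < n%:R.
  by apply: lt_le_trans (truncnS_gt t) _; rewrite ler_nat.
apply: (@le_lt_trans _ _ M); first by rewrite le_max lexx.
have -> : M = t `^ e by rewrite /t -powRrM mulVf ?gt_eqF // powRr1.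
by rewrite gt0_ltr_powR // nnegrE.
Qed.

Lemma powRnS_le (e : R) n : 0 <= e -> (0 < n)%N ->
  n.+1%:R `^ e <= 2 `^ e * n%:R `^ e.
Proof.
move=> e0 n0; rewrite -powRM // ge0_ler_powR ?nnegrE // -natrM ler_nat; lia.
Qed.

Lemma powRn_ge1 (e : R) n : 0 <= e -> (0 < n)%N -> 1 <= n%:R `^ e.
Proof.
move=> e0 n0; rewrite -[leLHS](powRr0 n%:R) ler_powR //.
by rewrite ler1n.
Qed.

Lemma transcendental_evalC_neq0 (z : R[i]) p :
  transcendental z -> p != 0 -> evalC p z != 0.
Proof.
move=> tz p0; apply/eqP => pz; apply: tz.
exists (map_poly (intr : int -> rat) p); last by rewrite pQtoC_int rootE; apply/eqP.
by rewrite -size_poly_gt0 size_rat_int_poly size_poly_gt0.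
Qed.

(** Consecutive irreducible factors [P n] eventually share a root, so the normalised value [t n]
    becomes constant; it is non-zero by transcendence, yet tends to 0. *)
Theorem gelfond_criterion (z : R[i]) (g b e : R) (n0 : nat) :
    transcendental z -> 0 <= g -> g <= b -> 0 < e ->
    (forall n, (n0 <= n)%N -> exists F : {poly int},
      [/\ (1 < size F)%N, (size F).-1%:R <= n%:R `^ g,
          log_mahler R F <= 2 * n%:R `^ b &
          cabs (evalC F z) <=
            expR (- (n%:R `^ e * weight (n%:R `^ g) (n%:R `^ b) F))]) ->
  False.
Proof.
move=> tz g0 gb e0 HF; have b0 := le_trans g0 gb.
pose c := ln (1 + cabs z); have z1 : 1 <= 1 + cabs z by rewrite lerDl cabs_ge0.
have c0 : 0 <= c by apply: ln_ge0.
have zc : cabs z <= expR c.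
  by rewrite lnK ?posrE ?(lt_le_trans ltr01) // lerDr.
(* This number serves as [kap]: since g <= b, it bounds the growth of both n^g and n^b from n to n +
   1. *)
have kap1 : 1 <= 2 `^ b by apply: (@powRn_ge1 b 2).
have [n1 Hn1] := powRn_gt_eventually (2 `^ b * (7 + 2 * c)) e0.
(* The successor makes every n >= [n2] positive. *)
pose n2 := (maxn n0 n1).+1.
(* The condition on n stands under the existential so that [choice] yields a sequence indexed by all
   n; below [n2] any polynomial will do. *)
have HP n : exists p, (n2 <= n)%N ->
    [/\ irreducible_poly p, (size p).-1%:R <= n%:R `^ g,
        log_mahler R p <= 2 * n%:R `^ b &
        cabs (evalC p z) <= expR (- (n%:R `^ e * weight (n%:R `^ g) (n%:R `^ b) p))].
  have [le_n|lt_n] := leqP n2 n; last by exists 0.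
  have [|F [F1 Fg Fb Fz]] := HF n.
    by apply: leq_trans (leq_maxl n0 n1) (ltnW le_n).
  have [p [irr szp mp pz]] := irreducible_factor_small F1 Fz.
  exists p => _; split; [exact: irr | | exact: le_trans mp Fb | exact: pz].
  by apply: le_trans Fg; rewrite ler_nat -!subn1 leq_sub2r.
have [P HPn] := choice HP => {HF HP}.
pose t n := evalC (P n) z / (lead_coef (P n))%:~R.
have lc0 n : (n2 <= n)%N -> (lead_coef (P n))%:~R != 0 :> R[i].
  by move=> /HPn[/irredp_neq0 p0 _ _ _]; rewrite intr_eq0 lead_coef_eq0.
have tS n : (n2 <= n)%N -> t n.+1 = t n.
  move=> le_n; have le_nS : (n2 <= n.+1)%N := leqW le_n.
  have n_gt0 : (0 < n)%N by apply: leq_trans le_n.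
  have [ip pg pb pz] := HPn _ le_n; have [iq qg qb qz] := HPn _ le_nS.
  have wS : 0 <= weight (n.+1%:R `^ g) (n.+1%:R `^ b) (P n.+1).
    by apply/ltW/weight_gt0; rewrite ?powR_ge0 ?powR_gt0 //; case: iq.
  have le_pow (d : R) : 0 <= d -> n%:R `^ d <= n.+1%:R `^ d.
    by move=> d0; rewrite ge0_ler_powR ?nnegrE // ler_nat.
  have gb_pow m : (0 < m)%N -> m%:R `^ g <= m%:R `^ b.
    by move=> m0; rewrite ler_powR // ler1n.
  have gk : n.+1%:R `^ g <= 2 `^ b * n%:R `^ g.
    apply: le_trans (powRnS_le g0 n_gt0) _; rewrite ler_wpM2r ?powR_ge0 //.
    by rewrite ler_powR // ler1n.
  (* The exponent of P_(n+1) is weakened from (n+1)^e to n^e, to have the same [y] for both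
     polynomials. *)
  have qz' : cabs (evalC (P n.+1) z) <=
      expR (- (n%:R `^ e * weight (n.+1%:R `^ g) (n.+1%:R `^ b) (P n.+1))).
    by apply: le_trans qz _; rewrite ler_expR lerN2 ler_wpM2r // le_pow // ltW.
  have ny : 2 `^ b * (7 + 2 * c) < n%:R `^ e.
    by apply: Hn1; apply: leq_trans (leq_maxr n0 n1) (ltnW le_n).
  have [x [px qx]] := small_irreducible_common_root ip iq kap1 c0 zc pg qg pb qb
    (gb_pow _ n_gt0) (gb_pow _ (ltn0Sn n)) (le_pow _ g0) (le_pow _ b0) gk
    (powRnS_le b0 n_gt0) ny pz qz'.
  have /(congr1 (fun r => r.[z])) := irreducible_int_assoc ip iq px qx.
  rewrite !hornerZ -!/(evalC _ _) => E; apply/eqP.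
  by rewrite /t eqr_div ?lc0 // mulrC -E mulrC.
have tE n : (n2 <= n)%N -> t n = t n2.
  by move=> /subnK <-; elim: (n - n2)%N => // k IH; rewrite addSn tS ?leq_addl.
have t_gt0 : 0 < cabs (t n2).
  rewrite lt_def cabs_ge0 cabs_eq0 mulf_neq0 ?invr_eq0 ?lc0 //.
  by apply: transcendental_evalC_neq0 => //; case: (HPn _ (leqnn n2)) => /irredp_neq0.
have [n3 Hn3] := powRn_gt_eventually (cabs (t n2))^-1 e0.
pose n := maxn n2 n3; have le_n : (n2 <= n)%N := leq_maxl _ _.
have ny := Hn3 n (leq_maxr _ _).
have [ip pg pb pz] := HPn n le_n.
have n_gt0 : (0 < n)%N by apply: leq_trans le_n.
have w1 : 1 <= weight (n%:R `^ g) (n%:R `^ b) (P n).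
  have d1 : 1 <= (size (P n)).-1%:R :> R by rewrite ler1n -subn1 subn_gt0; case: ip.
  apply: (@le_trans _ _ (n%:R `^ b * (size (P n)).-1%:R)).
    by apply: mulr_ege1 => //; apply: powRn_ge1.
  by rewrite lerDr mulr_ge0 ?powR_ge0 // log_mahler_ge0 // irredp_neq0.
have tn : cabs (t n2) <= expR (- (n%:R `^ e)).
  rewrite -(tE n le_n) /t cabsM; apply: (@le_trans _ _ (cabs (evalC (P n) z))).
    have l1 : 1 <= cabs ((lead_coef (P n))%:~R : R[i]).
      by apply: cabs_int_ge1; rewrite lead_coef_eq0 irredp_neq0.
    rewrite ler_piMr ?cabs_ge0 // cabsV invf_le1 //; exact: lt_le_trans ltr01 l1.
  by apply: le_trans pz _; rewrite ler_expR lerN2 ler_peMr ?powR_ge0.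
(* The choice of [n3] gives 1/|t| < n^e <= exp(n^e), against the upper bound for |t|. *)
move: tn; apply/negP; rewrite -ltNge expRN -[X in _ < X]invrK ltf_pV2 ?posrE ?expR_gt0 ?invr_gt0 //.
by apply: lt_le_trans ny _; rewrite (le_trans _ (expR_ge1Dx _)) // lerDr.
Qed.

End Gelfond.

(** * Primary polynomials *)

Section Reduction.
Variable R : realType.
Implicit Types p q Q : {poly int}.

Local Notation pZtoC := (map_poly (intr : int -> R[i])).

Lemma prod_ge_expR (T : eqType) (s : seq T) (g : T -> R) (t : R) :
  (forall b, b \in s -> expR t <= g b) ->
  expR (t * (size s)%:R) <= \prod_(b <- s) g b.
Proof.
elim: s => [|b s IH] H; first by rewrite big_nil mulr0 expR0.
rewrite big_cons /= -natr1 mulrDr mulr1 addrC expRD.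
apply: ler_pM; rewrite ?expR_ge0 ?H ?mem_head //; apply: IH => k ks.
by rewrite H // in_cons ks orbT.
Qed.

(** If the head is the exceptional factor, all the others exceed exp(-U); otherwise it is charged U
    and the exception is left to the tail. *)
Lemma prod_ge_one_exception (T : eqType) (s : seq T) (g : T -> R) (U V : R) :
    0 <= U -> 0 <= V -> uniq s ->
    (forall b, b \in s -> expR (- V) <= g b) ->
    (forall b b', b \in s -> b' \in s -> b != b' ->
      g b <= expR (- U) -> g b' <= expR (- U) -> False) ->
  expR (- (U * (size s)%:R + V)) <= \prod_(b <- s) g b.
Proof.
move=> U0 V0; elim: s => [|b s IH] /=.
  by move=> _ _ _; rewrite big_nil mulr0 add0r expR_le1 oppr_le0.
move=> /andP[bs us] gV gU; rewrite big_cons -natr1 mulrDr mulr1.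
have in_s k : k \in s -> k \in b :: s by rewrite in_cons => ->; rewrite orbT.
have [gb|gb] := leP (g b) (expR (- U)).
  have H : expR (- U * (size s)%:R) <= \prod_(b <- s) g b.
    apply: prod_ge_expR => k ks; rewrite leNgt; apply/negP => /ltW gk.
    by apply: (gU b k) gb gk; rewrite ?mem_head ?in_s //; apply: contraNneq bs => ->.
  apply: le_trans (ler_pM (expR_ge0 _) (expR_ge0 _) (gV b (mem_head _ _)) H).
  by rewrite -expRD ler_expR mulNr -opprD lerN2 addrC lerD2r lerDl.
have H : expR (- (U * (size s)%:R + V)) <= \prod_(b <- s) g b.
  apply: IH => // [k ks|k k' ks k's]; first by apply: gV; rewrite in_s.
  by apply: gU; rewrite in_s.
apply: le_trans (ler_pM (expR_ge0 _) (expR_ge0 _) (ltW gb) H).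
by rewrite -expRD ler_expR -opprD lerN2 addrA [U + _]addrC.
Qed.

Lemma evalC_compXn Q m (z : R[i]) : evalC (Q \Po 'X^m) z = evalC Q (z ^+ m).
Proof. by rewrite /evalC map_comp_poly horner_comp map_polyXn hornerXn. Qed.

Lemma size_compXn Q m : (size (Q \Po 'X^m)).-1 = ((size Q).-1 * m)%N.
Proof. by rewrite size_comp_poly size_polyXn. Qed.

Lemma l1norm_int_compXn Q m : l1norm (pZtoC (Q \Po 'X^m)) <= l1norm (pZtoC Q).
Proof. by rewrite map_comp_poly map_polyXn l1norm_compXn. Qed.

Lemma evalC_zprimitive Q (z : R[i]) :
  evalC Q z = (zcontents Q)%:~R * evalC (zprimitive Q) z.
Proof. by rewrite {1}/evalC {1}(zpolyEprim Q) map_polyZ /= hornerZ. Qed.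

(** The height bounds each coefficient of the primitive part, and their number is at most deg + 1 <=
    exp(deg). *)
Lemma l1norm_zprimitive Q t : Q != 0 -> height R Q <= expR t ->
  l1norm (pZtoC (zprimitive Q)) <= (expR ((size Q).-1%:R + t))%:C%C.
Proof.
move=> Q0 Ht; have c0 : zcontents Q != 0 by rewrite zcontents_eq0.
have cabs0 : 0 < `|zcontents Q|%N%:R :> R by rewrite ltr0n absz_gt0.
have coefE i : `|(pZtoC (zprimitive Q))`_i| <= (expR t)%:C%C.
  rewrite coef_map /= -intr_norm -abszE.
  have [lt_i|le_i] := ltnP i (size Q); last first.
    rewrite nth_default ?size_zprimitive // absz0.
    by rewrite -[0%:~R]/(0%:C%C) lecR expR_ge0.
  rewrite -[X in X <= _]/((`|((zprimitive Q)`_i)%R|%N)%:R) -(rmorph_nat (@real_complex R)).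
  rewrite lecR; apply: le_trans Ht; rewrite /height ler_pdivlMr // -natrM ler_nat.
  rewrite mulnC -abszM -coefZ -zpolyEprim.
  exact: (@leq_bigmax _ (fun i : 'I_(size Q) => `|(Q`_i)%R|%N) (Ordinal lt_i)).
apply: (@le_trans _ _ (\sum_(i < size Q) (expR t)%:C%C)).
  by rewrite /l1norm size_pZtoC size_zprimitive; apply: ler_sum.
rewrite -rmorph_sum /= lecR sumr_const card_ord -[leLHS]mulr_natl.
rewrite expRD ler_wpM2r ?expR_ge0 // -(@prednK (size Q)) ?size_poly_gt0 //.
by rewrite -natr1 addrC expR_ge1Dx.
Qed.

(** A common root x makes x^b and x^b' roots of the irreducible polynomial of which [Q] is a power,
    and [irreducible_two_powers] then produces a forbidden root. *)
Lemma primary_compXn_coprime Q b b' x :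
    primary Q -> no_zero_or_unity_root R Q -> (1 < size Q)%N ->
    (0 < b)%N -> (0 < b')%N -> b != b' ->
  root (pZtoC (zprimitive Q \Po 'X^b)) x ->
  root (pZtoC (zprimitive Q \Po 'X^b')) x -> False.
Proof.
move=> [P [k [irrP k0 QE]]] nz Q1 b0 b'0 bb'.
have P1 : (1 < size P)%N.
  rewrite ltnNge; apply/negP => /size1_polyC PE; move: Q1; rewrite QE PE -rmorphXn.
  by rewrite ltnNge size_polyC_leq1.
have irr := (irreducible_rat_int P).2 (irreducible_elt_poly irrP P1).
have QP z : evalC Q z = evalC P z ^+ k by rewrite /evalC QE rmorphXn horner_exp.
have rootP m : root (pZtoC (zprimitive Q \Po 'X^m)) x ->
    root (map_poly (ratr : rat -> R[i]) (map_poly (intr : int -> rat) P)) (x ^+ m).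
  rewrite pQtoC_int !rootE -![_.[_]]/(evalC _ _) evalC_compXn => /eqP zx.
  have := evalC_zprimitive Q (x ^+ m); rewrite zx mulr0 QP => /eqP.
  by rewrite expf_eq0 k0.
move=> /rootP xb /rootP xb'.
have [y py Hy] := irreducible_two_powers irr b0 b'0 bb' xb xb'.
have [|y0 yu] := nz y.
  by move: py; rewrite pQtoC_int rootE QP => /eqP py; rewrite /evalC py expr0n gtn_eqF.
by case: Hy => [//|[m m0 /yu]]; apply.
Qed.

End Reduction.

(* The polynomials Q(T^b) and Q(T^b') are coprime, so their resultant bounds
   their common smallness at xi^a: for each a, at most one value is small. *)
Lemma separated_values (R : realType) (Q : {poly int}) (xi : R[i]) (c u v X : R)
    (a b b' : nat) :
    primary Q -> no_zero_or_unity_root R Q -> (1 < size Q)%N ->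
    0 <= c -> cabs xi <= expR c -> 1 <= X -> 1 <= u -> X <= v -> u <= v ->
    (size Q).-1%:R <= u -> height R Q <= expR v ->
    (0 < b)%N -> (0 < b')%N -> b != b' ->
    a%:R <= X -> b%:R <= X -> b'%:R <= X ->
    cabs (evalC (zprimitive Q) (xi ^+ (a * b))) <= expR (- ((7 + 2 * c) * (u * v * X))) ->
    cabs (evalC (zprimitive Q) (xi ^+ (a * b'))) <= expR (- ((7 + 2 * c) * (u * v * X))) ->
  False.
Proof.
move=> prQ nzQ Q1 c0 xic X1 u1 Xv uv Qu Qv b0 b'0 bb' aX bX b'X.
have Q0 : Q != 0 by rewrite -size_poly_gt0 ltnW.
(* The exponent 2v covers the degree, at most u <= v, and the logarithmic height v. *)
have l1 m : l1norm (map_poly (intr : int -> R[i]) (zprimitive Q \Po 'X^m)) <=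
    (expR (2 * v))%:C%C.
  apply: le_trans (l1norm_int_compXn _ _ _) _; apply: le_trans (l1norm_zprimitive Q0 Qv) _.
  by rewrite lecR ler_expR; lra.
have sz m : (0 < m)%N -> (1 < size (zprimitive Q \Po 'X^m))%N.
  move=> m0; have : (0 < (size (zprimitive Q \Po 'X^m)).-1)%N.
    by rewrite size_compXn size_zprimitive muln_gt0 m0 -subn1 subn_gt0 Q1.
  by case: (size _) => [|[]].
rewrite !exprM => pv qv; rewrite -evalC_compXn in pv; rewrite -evalC_compXn in qv.
have xia : cabs (xi ^+ a) <= expR (c * a%:R).
  by rewrite cabsX expRM_natr lerXn2r ?nnegrE ?cabs_ge0 ?expR_ge0.
have := coprime_values_lb (sz _ b0) (sz _ b'0)
  (fun x => primary_compXn_coprime prQ nzQ Q1 b0 b'0 bb' (x := x))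
  (mulr_ge0 c0 (ler0n _ a)) xia (l1 b) (l1 b') pv qv.
rewrite !size_compXn size_zprimitive !natrM.
move: Qu aX bX b'X; set d := (size Q).-1%:R; set ra := a%:R; set rb := b%:R; set rb' := b'%:R.
move=> du aX bX b'X H.
have d0 : 0 <= d by apply: ler0n.
have rb0 : 0 <= rb by apply: ler0n.
have rb'0 : 0 <= rb' by apply: ler0n.
have {}H : (7 + 2 * c) * (u * v * X) <= (1 + c * ra + 2 * v) * (d * (rb + rb')).
  apply: le_trans H _; rewrite le_eqVlt; apply/orP; left; apply/eqP; ring.
have e1 : c * ra <= c * v by rewrite ler_wpM2l //; lra.
have e2 : d * (rb + rb') <= u * (2 * X) by apply: ler_pM => //; lra.
have e3 : (1 + c * ra + 2 * v) * (d * (rb + rb')) <= ((3 + c) * v) * (u * (2 * X)).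
  apply: ler_pM => //; [| by rewrite mulr_ge0 //; lra |].
    by rewrite !addr_ge0 ?mulr_ge0 ?ler0n //; lra.
  lra.
have uvX : 0 < u * v * X by rewrite !mulr_gt0 //; lra.
move: H; apply/negP; rewrite -ltNge; apply: le_lt_trans e3 _.
(* The resultant gives 6 + 2c against the assumed 7 + 2c, whence the strict inequality. *)
have -> : (3 + c) * v * (u * (2 * X)) = (6 + 2 * c) * (u * v * X) by ring.
by rewrite ltr_pM2r //; lra.
Qed.

(** Here [u], [v], [X], [y] stand for n^alpha, n^beta, n^(mu/2), n^e. If no pair fell below exp(-V),
    each a would cost at most U |B| + V in the exponent, too little for the assumed smallness. *)
Lemma primary_small_value (R : realType) (Q : {poly int}) (xi : R[i]) (c u v X y : R)
    (A B : seq nat) :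
    primary Q -> no_zero_or_unity_root R Q ->
    0 <= c -> cabs xi <= expR c -> 1 <= X -> 1 <= u -> X <= v -> u <= v ->
    (size Q).-1%:R <= u -> height R Q <= expR v -> 10 + 2 * c < y ->
    uniq A -> uniq B -> (size A)%:R <= X -> (size B)%:R <= X ->
    (forall a, a \in A -> (0 < a)%N /\ a%:R <= X) ->
    (forall b, b \in B -> (0 < b)%N /\ b%:R <= X) ->
    \prod_(a <- A) \prod_(b <- B) cabs (evalC Q (xi ^+ (a * b)))
      <= expR (- (u * v * X ^+ 3 * y ^+ 2)) ->
  exists F : {poly int}, [/\ (1 < size F)%N, (size F).-1%:R <= u * X ^+ 2,
    log_mahler R F <= 2 * v &
    cabs (evalC F xi) <= expR (- (y * weight (u * X ^+ 2) v F))].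
Proof.
move=> prQ nzQ c0 xic X1 u1 Xv uv Qu Qv cy uA uB sA sB HA HB small.
have Q0 : Q != 0 by case: prQ => P [k [[P0 _ _] _ ->]]; rewrite expf_neq0.
pose Q' := zprimitive Q; have Q'0 : Q' != 0 by rewrite zprimitive_eq0.
pose g a b := cabs (evalC Q' (xi ^+ (a * b))).
have uvX : 0 < u * v * X ^+ 3 by rewrite !mulr_gt0 ?exprn_gt0 //; lra.
(* Dividing by the content, a non-zero integer, can only decrease the values. *)
have small' : \prod_(a <- A) \prod_(b <- B) g a b <= expR (- (u * v * X ^+ 3 * y ^+ 2)).
  apply: le_trans small; apply: ler_prod => a _.
  rewrite prodr_ge0 => [|b _]; last exact: cabs_ge0.
  apply: ler_prod => b _; rewrite cabs_ge0 /= evalC_zprimitive cabsM ler_peMl ?cabs_ge0 //.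
  by rewrite cabs_int_ge1 // zcontents_eq0.
(* For constant [Q] all the values are non-zero integers, so their product cannot be small. *)
have [Q1|Q1] := ltnP 1 (size Q); last first.
  have [k k0 Q'E] : exists2 k, k != 0 & Q' = k%:P.
    by apply/size_poly1P; rewrite eqn_leq size_zprimitive Q1 size_poly_gt0.
  have g1 a b : 1 <= g a b by rewrite /g Q'E /evalC map_polyC hornerC cabs_int_ge1.
  have : 1 <= \prod_(a <- A) \prod_(b <- B) g a b.
    elim: (A) => [|a s IH]; rewrite ?big_nil // big_cons mulr_ege1 //.
    by elim: (B) => [|b r IHr]; rewrite ?big_nil // big_cons mulr_ege1.
  move=> /le_trans/(_ small'); rewrite -expR0 ler_expR oppr_ge0 leNgt mulr_gt0 ?exprn_gt0 //.
  lra.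
(* [U] is the threshold of [separated_values]; [V] is [y] times 3uvX^2, an upper bound for the
   weight of Q'(T^(ab)). *)
pose U := (7 + 2 * c) * (u * v * X); pose V := 3 * y * (u * v * X ^+ 2).
have U0 : 0 <= U by rewrite /U !mulr_ge0 //; lra.
have V0 : 0 <= V by rewrite /V !mulr_ge0 ?exprn_ge0 //; lra.
have [a [b [aA bB gab]]] : exists a b, [/\ a \in A, b \in B & g a b <= expR (- V)].
  apply: contrapT => none.
  have gV a b : a \in A -> b \in B -> expR (- V) <= g a b.
    move=> aA bB; rewrite leNgt; apply/negP => /ltW gab; apply: none.
    by exists a, b.
  have ga a : a \in A -> expR (- (U * (size B)%:R + V)) <= \prod_(b <- B) g a b.
    move=> aA; apply: prod_ge_one_exception => // [b|b b' bB b'B bb'].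
      exact: gV.
    have [b0 bX] := HB _ bB; have [b'0 b'X] := HB _ b'B; have [_ aX] := HA _ aA.
    exact: (@separated_values R Q xi c u v X a b b').
  have := le_trans (prod_ge_expR ga) small'; rewrite ler_expR mulNr lerN2.
  apply/negP; rewrite -ltNge.
  have s0 : 0 <= (size A)%:R :> R by apply: ler0n.
  have t0 : 0 <= (size B)%:R :> R by apply: ler0n.
  apply: (@le_lt_trans _ _ ((U * X + V) * X)).
    apply: ler_pM => //; first exact: (addr_ge0 (mulr_ge0 U0 t0) V0).
    by rewrite lerD2r ler_wpM2l.
  (* The lower bound on [y] is tailored to 7 + 2c + 3y <= (10 + 2c) y < y^2. *)
  have -> : (U * X + V) * X = u * v * X ^+ 3 * (7 + 2 * c + 3 * y) by rewrite /U /V; ring.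
  rewrite ltr_pM2l //; have : (10 + 2 * c) * y < y ^+ 2 by rewrite expr2 ltr_pM2r //; lra.
  have : (7 + 2 * c) * 1 <= (7 + 2 * c) * y by rewrite ler_pM2l; lra.
  lra.
have [a0 aX] := HA _ aA; have [b0 bX] := HB _ bB.
have degF : (size (Q' \Po 'X^(a * b))).-1%:R <= u * X ^+ 2 :> R.
  rewrite size_compXn size_zprimitive !natrM expr2.
  by apply: ler_pM; rewrite ?mulr_ge0 ?ler0n //; apply: ler_pM; rewrite ?ler0n.
have F1 : (1 < size (Q' \Po 'X^(a * b)))%N.
  have : (0 < (size (Q' \Po 'X^(a * b))).-1)%N.
    by rewrite size_compXn size_zprimitive !muln_gt0 a0 b0 -subn1 subn_gt0 Q1.
  by case: (size _) => [|[]].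
have mF : log_mahler R (Q' \Po 'X^(a * b)) <= 2 * v.
  apply: log_mahler_le; first by rewrite -size_poly_gt0 ltnW.
  apply: le_trans (l1norm_int_compXn _ _ _) _; apply: le_trans (l1norm_zprimitive Q0 Qv) _.
  by rewrite lecR ler_expR; lra.
exists (Q' \Po 'X^(a * b)); split => //.
rewrite evalC_compXn; apply: le_trans gab _; rewrite ler_expR lerN2 /V.
have -> : 3 * y * (u * v * X ^+ 2) = y * (u * X ^+ 2 * (2 * v) + v * (u * X ^+ 2)) by ring.
rewrite ler_wpM2l //; first by lra.
rewrite /weight lerD // ler_wpM2l //; last by lra.
by rewrite mulr_ge0 ?exprn_ge0 //; lra.
Qed.

(** * From a finite exceptional set to Gel'fond's criterion *)

Lemma fset_size_le (A : {fset nat}) N :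
  (forall a, a \in A -> (1 <= a <= N)%N) -> (size A <= N)%N.
Proof.
move=> HA; rewrite -(size_iota 1 N); apply: uniq_leq_size; first exact: fset_uniq.
by move=> a /HA; rewrite mem_iota add1n ltnS.
Qed.

Theorem theorem11p1 (R : realType) (xi : R[i]) (alpha beta mu omega : R)
    (hxi : transcendental xi)
    (hmu : 0 < mu) (halpha : mu <= alpha) (hbeta : alpha + mu <= beta)
    (homega : alpha + beta + 3 / 2 * mu < omega) :
  infinite_set
    [set n : nat | (0 < n)%N /\
      ~ exists Q : {poly int},
          [/\ primary Q,
              no_zero_or_unity_root R Q,
              (size Q).-1%:R <= n%:R `^ alpha,
              height R Q <= expR (n%:R `^ beta) &
              exists A B : {fset nat},
                [/\ A <> fset0, B <> fset0,
                    forall a, a \in A -> (1 <= a <= Num.truncn (n%:R `^ (mu / 2)))%N,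
                    forall b, b \in B -> (1 <= b <= Num.truncn (n%:R `^ (mu / 2)))%N &
                    \prod_(a <- A) \prod_(b <- B) `|evalC Q (xi ^+ (a * b)%N)|
                      <= (expR (- (n%:R `^ omega)))%:C%C]]]%classic.
Proof.
move=> /finite_seqP[s sE].
(* Half of the gap, because the hypothesis of [primary_small_value] involves y^2 = n^(2e). *)
pose e := (omega - (alpha + beta + 3 / 2 * mu)) / 2.
have e0 : 0 < e by rewrite /e; lra.
pose c := ln (1 + cabs xi); have xi1 : 1 <= 1 + cabs xi by rewrite lerDl cabs_ge0.
have c0 : 0 <= c by apply: ln_ge0.
have xic : cabs xi <= expR c.
  by rewrite lnK ?posrE ?(lt_le_trans ltr01) // lerDr.
have [n1 Hn1] := powRn_gt_eventually (10 + 2 * c) e0.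
(* From [n2] on, n exceeds every exceptional integer and n^e exceeds 10 + 2c. *)
pose n2 := maxn n1 (\max_(i <- s) i).+1.
have am0 : 0 <= alpha + mu by lra.
apply: (gelfond_criterion (n0 := n2) hxi am0 hbeta e0) => n le_n.
have lt_s : (\max_(i <- s) i < n)%N := leq_trans (leq_maxr n1 _) le_n.
have n0 : (0 < n)%N := leq_ltn_trans (leq0n _) lt_s.
have : n \notin s.
  by apply: contraL lt_s => ns; rewrite -leqNgt (leq_bigmax_seq (F := id)).
(* If no suitable polynomial existed for this n, then n would be exceptional and hence listed in
   [s]. *)
move=> /negP ns; apply: contrapT => noF; apply: ns.
suff : [set` s]%classic n by [].
rewrite -sE; split => // -[Q [prQ nzQ degQ htQ [A [B [_ _ HA HB prod]]]]].
apply: noF; set x := n%:R : R.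
have x1 : 1 <= x by rewrite ler1n.
have x0 : x != 0 by rewrite gt_eqF // (lt_le_trans ltr01).
have powD a b : x `^ (a + b) = x `^ a * x `^ b by rewrite powRD // x0 implybT.
pose X := x `^ (mu / 2).
have trX k : (1 <= k <= Num.truncn X)%N -> (0 < k)%N /\ k%:R <= X.
  by move=> /andP[k1 kX]; split => //; rewrite -truncn_ge_nat ?powR_ge0.
have szX (E : {fset nat}) : (forall a, a \in E -> (1 <= a <= Num.truncn X)%N) ->
    (size E)%:R <= X.
  by move=> HE; rewrite -truncn_ge_nat ?powR_ge0 // fset_size_le.
have X2 : X ^+ 2 = x `^ mu by rewrite expr2 -powD; congr (_ `^ _); lra.
rewrite powD -X2.
apply: (@primary_small_value R Q xi c _ _ X _ A B) => //.
- by apply: powRn_ge1 => //; lra.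
- by apply: powRn_ge1 => //; lra.
- by rewrite ler_powR //; lra.
- by rewrite ler_powR //; lra.
- by apply: Hn1; apply: leq_trans le_n; apply: leq_maxl.
- exact: fset_uniq.
- exact: fset_uniq.
- exact: szX.
- exact: szX.
- by move=> a /HA/trX.
- by move=> b /HB/trX.
have -> : x `^ alpha * x `^ beta * X ^+ 3 * (x `^ e) ^+ 2 = x `^ omega.
  rewrite exprS X2 expr2 /X -!powD; congr (_ `^ _); rewrite /e; lra.
rewrite -lecR; apply: le_trans prod; rewrite rmorph_prod /= le_eqVlt; apply/orP; left.
apply/eqP/eq_bigr => a _; rewrite rmorph_prod /=; apply: eq_bigr => b _.
by rewrite cabsE.
Qed.
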